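(* Let $d,m\geq 2$ and $n\geq 1$ be integers, let $c_0\in\overline{\mathbb{Q}}$, let $K:=\mathbb{Q}(c_0)$, and fix a finite place $v$ of $K$. Suppose $f=f_{d,c_0}$ is PCF of exact type $(m,n)$ with $m>0$. Then: (1) If $v(d)=0$, then $v(a_i(c_0))=0$ for all $i\geq 1$. (2) Suppose $d=p^e$ is a prime power. Let $\zeta:=a_{m+n-1}(c_0)/a_{m-1}(c_0)\neq 1$ and let $0\leq r\leq e-1$ be the smallest nonnegative integer with $\zeta^{p^{r+1}}=1$. Then for all $i\geq 1$: (a) if $n\nmid m-1$, then $p^r(p-1)d^{m-1}v(a_i(c_0))=v(p)$ if $n\mid i$ and $=0$ if $n\nmid i$; (b) if $n\mid m-1$, then $p^r(p-1)(d^{m-1}-1)v(a_i(c_0))=v(p)$ if $n\mid i$ and $=0$ if $n\nmid i$.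
   Context: $f_{d,c}(z)=z^d+c$, $a_i(c):=f_{d,c}^i(0)\in\mathbb{Z}[c]$. $f_{d,c_0}$ is PCF of exact type $(m,n)$ if $f^{m+n}(0)=f^m(0)$ with $m\geq 0$, $n\geq 1$ minimal. In that situation $a_{m-1}(c_0)\neq 0$ and $a_{m+n-1}(c_0)/a_{m-1}(c_0)$ is a $d$-th root of unity different from $1$. $v(\cdot)$ denotes the additive valuation of the finite place $v$. *)

(* Defs.v *)
From HB Require Import structures.
From mathcomp Require Import all_boot all_order all_algebra all_field.
From mathcomp Require Import constructive_ereal.

Set Implicit Arguments.
Unset Strict Implicit.
Unset Printing Implicit Defensive.

Import Order.TTheory GRing.Theory Num.Theory.
Local Open Scope ring_scope.

Definition unicrit (A : nzRingType) (d : nat) (c z : A) : A := z ^+ d + c.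

(* The variable c of Z[c] is 'X. *)
Definition crit_poly (d i : nat) : {poly int} := iter i (unicrit d 'X) 0.

Definition crit_at (A : nzRingType) (d i : nat) (c : A) : A :=
  (map_poly intr (crit_poly d i)).[c].

(* For a preperiodic point the least preperiod and the least period are
   attained by the same pair, so minimality is imposed on both at once. *)
Definition exact_type (A : nzRingType) (d : nat) (c : A) (m n : nat) : Prop :=
  let orb i := iter i (unicrit d c) 0 in
  [/\ (1 <= n)%N, orb (m + n)%N = orb m
    & forall m' n' : nat, (1 <= n')%N -> orb (m' + n')%N = orb m' ->
        (m <= m')%N /\ (n <= n')%N].

Definition minQpoly (c0 : algC) : {poly rat} := sval (minCpolyP c0).

(* The field Q(c0), as a type, and c0 as an element of it. *)
Definition Qadj (c0 : algC) : fieldType :=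
  subFExtend (ratr : rat -> algC) c0 (minQpoly c0).

Definition Qadj_gen (c0 : algC) : Qadj c0 :=
  subfx_root (ratr : rat -> algC) c0 (minQpoly c0).

Definition Qadj_inj (c0 : algC) : Qadj c0 -> algC :=
  @subfx_inj _ _ (ratr : rat -> algC) c0 (minQpoly c0).

HB.instance Definition _ (c0 : algC) := GRing.RMorphism.on (@Qadj_inj c0).

Lemma Qadj_inj_gen (c0 : algC) : Qadj_inj (Qadj_gen c0) = c0.
Proof.
rewrite /Qadj_inj /Qadj_gen /minQpoly; case: minCpolyP => p [Ep mon_p] _ /=.
by apply: subfx_inj_root; rewrite ?monic_neq0 // -Ep root_minCpoly.
Qed.

(* A finite place of a number field, given by one of its additive valuations:
   a nontrivial nonarchimedean valuation with value +oo at 0 only.  The values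
   lie in an archimedean ordered domain R, i.e. an ordered subring of the real
   numbers; no normalization is imposed, so that R = int with v onto,
   R = rat with v p = 1, and R the reals with v = - log |.| are all covered. *)
Record finite_place (R : archiRealDomainType) (K : fieldType) := FinitePlace {
  place_val :> K -> \bar R;
  place_val0 : place_val 0 = +oo%E;
  place_val_fin : forall x, x != 0 -> place_val x \is a fin_num;
  place_valM : forall x y, place_val (x * y) = (place_val x + place_val y)%E;
  place_valD : forall x y,
    (Order.min (place_val x) (place_val y) <= place_val (x + y))%E;
  place_val_nontrivial : exists2 x, x != 0 & place_val x != 0%E
}.

(* Main.v *)
Require Import Defs.
From HB Require Import structures.
From mathcomp Require Import all_boot all_order all_algebra all_field.
From mathcomp Require Import constructive_ereal.
From mathcomp Require Import ring lra.
Set Implicit Arguments.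
Unset Strict Implicit.

Import Order.TTheory GRing.Theory Num.Theory.
Local Open Scope ring_scope.

(* Write [D j = a_(j+n) - a_j], so that [D (j+1) = a_(j+n)^d - a_j^d] and
   [D 1 = a_n^d].

   If [v d = 0] and some [v (a_i)] is positive, the orbit of [0] is purely
   periodic modulo [v]; then [v (a_n)] and [v (a_(m-1))] have the same positive
   value [w], while [D (m-1) = (zeta - 1) a_(m-1)] has valuation both [w] (as
   [zeta - 1] is a unit) and at least [d w], a contradiction.

   If [d = p^e] and [v p > 0], then [z^d + c] is injective on the residue field
   and strictly contracts residue discs.  Hence [v (a_n) = w > 0], and
   [v (a_i) > 0] exactly when [n] divides [i], with common value [w].  As [p]
   divides the inner binomial coefficients, [D (j+1) = (D j)^d + p (D j) u] with
   [u] integral: either [(d-1) v (D j) < v p] and [v (D (j+1)) = d v (D j)], or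
   [v (D (j+1)) >= v p + v (D j)].  For [1 <= j < m-1] the second case would
   make [v (D (m-1))] exceed its value [v (zeta - 1) + v (a_(m-1))], so
   [d^(m-1) w = v (zeta - 1) + v (a_(m-1))], and
   [p^r (p-1) v (zeta - 1) = v p] because [zeta] has order [p^(r+1)]. *)

(** * Additive valuations: ultrametric rules and roots of unity *)

Section Valuation.
Variables (R : archiRealDomainType) (K : fieldType) (v : finite_place R K).
Implicit Types (x y z : K) (t : R).

Local Notation w x := (fine (v x)).

Lemma place_fineK x : x != 0 -> (w x)%:E = v x.
Proof. by move=> x0; apply/fineK/place_val_fin. Qed.

Lemma place_val_neq0 x t : v x = t%:E -> x != 0.
Proof. by move=> vx; apply/eqP => x0; move: vx; rewrite x0 place_val0. Qed.

Lemma place_val1 : v 1 = 0%E.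
Proof.
have := place_valM v 1 1; rewrite mulr1 -(place_fineK (oner_neq0 _)) -EFinD.
by case=> h; congr EFin; lra.
Qed.

Lemma place_valX x k : x != 0 -> v (x ^+ k) = (w x *+ k)%:E.
Proof.
move=> x0; elim: k => [|k IH]; first by rewrite expr0 mulr0n place_val1.
by rewrite exprS place_valM IH -(place_fineK x0) -EFinD mulrS.
Qed.

Lemma place_val_unity z k : (0 < k)%N -> z ^+ k = 1 -> v z = 0%E.
Proof.
move=> k0 zk; have z0 : z != 0.
  apply/eqP => z0; move: zk; rewrite z0 expr0n gtn_eqF // => /esym/eqP.
  by rewrite oner_eq0.
have := place_valX k z0.
rewrite zk place_val1 -(place_fineK z0) => -[/esym/eqP].
by rewrite mulrn_eq0 gtn_eqF //= => /eqP ->.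
Qed.

Lemma place_valN x : v (- x) = v x.
Proof.
by rewrite -mulN1r place_valM (@place_val_unity _ 2) ?add0e // sqrrN expr1n.
Qed.

Lemma place_valBC x y : v (x - y) = v (y - x).
Proof. by rewrite -place_valN opprB. Qed.

Lemma place_valD_ge (b : \bar R) x y :
  (b <= v x)%E -> (b <= v y)%E -> (b <= v (x + y)%R)%E.
Proof.
by move=> bx by_; apply: le_trans (place_valD v x y); rewrite le_min bx.
Qed.

Lemma place_valD_gt (b : \bar R) x y :
  (b < v x)%E -> (b < v y)%E -> (b < v (x + y)%R)%E.
Proof.
by move=> bx by_; apply: lt_le_trans (place_valD v x y); rewrite lt_min bx.
Qed.

Lemma place_valB_gt (b : \bar R) x y :
  (b < v x)%E -> (b < v y)%E -> (b < v (x - y)%R)%E.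
Proof. by move=> bx by_; apply: place_valD_gt; rewrite ?place_valN. Qed.

Lemma place_valD_lt x y : (v x < v y)%E -> v (x + y) = v x.
Proof.
move=> xy; apply/le_anti/andP; split; last by rewrite place_valD_ge // ltW.
rewrite leNgt; apply/negP => lt_x; have := place_valB_gt lt_x xy.
by rewrite addrK ltxx.
Qed.

Lemma place_val_sum_ge0 (I : Type) (s : seq I) (P : pred I) (F : I -> K) :
  (forall i, P i -> (0 <= v (F i))%E) -> (0 <= v (\sum_(i <- s | P i) F i)%R)%E.
Proof.
move=> F0; elim/big_ind: _ => [|x y|//]; first by rewrite place_val0 leey.
exact: place_valD_ge.
Qed.

Lemma place_valM_ge0 x y :
  (0 <= v x)%E -> (0 <= v y)%E -> (0 <= v (x * y)%R)%E.
Proof. by rewrite place_valM; exact: adde_ge0. Qed.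

Lemma place_valX_ge0 x k : (0 <= v x)%E -> (0 <= v (x ^+ k)%R)%E.
Proof.
move=> x0; elim: k => [|k IH]; first by rewrite place_val1.
by rewrite exprS place_valM_ge0.
Qed.

Lemma place_val_nat_ge0 k : (0 <= v k%:R%R)%E.
Proof.
elim: k => [|k IH]; first by rewrite place_val0 leey.
by rewrite -natr1 place_valD_ge ?place_val1.
Qed.

Lemma place_valM_ge x y : (0 <= v y)%E -> (v x <= v (x * y)%R)%E.
Proof. by move=> y0; rewrite place_valM leeDl. Qed.

Lemma place_val_subX x y k :
  (0 <= v x)%E -> (0 <= v y)%E -> (v (x - y)%R <= v (x ^+ k - y ^+ k)%R)%E.
Proof.
move=> x0 y0; rewrite subrXX; apply/place_valM_ge/place_val_sum_ge0 => i _.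
by rewrite place_valM_ge0 ?place_valX_ge0.
Qed.

Lemma place_valX_gt0 x k : (0 < k)%N -> (0 < v (x ^+ k)%R)%E = (0 < v x)%E.
Proof.
move=> k0; have [->|x0] := eqVneq x 0; first by rewrite expr0n gtn_eqF.
by rewrite place_valX // -(place_fineK x0) !lte_fin pmulrn_lgt0.
Qed.

(** Each of [1 - z] and [1 - z ^+ k] divides the other up to an integral factor, because [z] is in
    turn a power of [z ^+ k]. *)
Lemma place_val_1Bprim N z k : N.-primitive_root z -> coprime k N ->
  v (1 - z ^+ k) = v (1 - z).
Proof.
move=> zN kN; have N0 := prim_order_gt0 zN.
have le1 y j : y ^+ N = 1 -> (v (1 - y)%R <= v (1 - y ^+ j)%R)%E.
  move=> yN; rewrite -[X in X - y ^+ j](expr1n _ j).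
  by rewrite place_val_subX ?place_val1 ?(place_val_unity N0 yN).
apply/eqP; rewrite eq_le le1 ?(prim_expr_order zN) // andbT.
have zkN : N.-primitive_root (z ^+ k) by rewrite prim_root_exp_coprime.
have [i {2}->] := prim_rootP zkN (prim_expr_order zN).
exact/le1/prim_expr_order.
Qed.

Lemma place_val_prod_const (s : seq nat) (F : nat -> K) x :
  x != 0 -> (forall i, i \in s -> v (F i) = v x) ->
  v (\prod_(i <- s) F i) = (w x *+ size s)%:E.
Proof.
move=> x0; elim: s => [|i s IH] Fs; first by rewrite big_nil place_val1.
rewrite big_cons place_valM Fs ?mem_head // IH => [|j js].
  by rewrite -(place_fineK x0) -EFinD mulrS.
by rewrite Fs // in_cons js orbT.
Qed.

Lemma prim_root_1B_neq0 N z : (1 < N)%N -> N.-primitive_root z -> 1 - z != 0.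
Proof.
move=> N1 zN; rewrite subr_eq0 eq_sym -[z]expr1.
by rewrite -(prim_order_dvd zN) dvdn1 gtn_eqF.
Qed.

Lemma place_val_prime_root p z : prime p -> p.-primitive_root z ->
  v p%:R = (w (1 - z) *+ (p - 1))%:E.
Proof.
move=> pp zp; have p1 := prime_gt1 pp; have z1 := prim_root_1B_neq0 p1 zp.
have -> : p%:R = \prod_(1 <= i < p) (1 - z ^+ i) :> K.
  (* Cancel ['X - 1] from two factorizations of ['X ^+ p - 1], then evaluate at 1. *)
  have := factor_Xn_sub_1 zp; rewrite big_ltn ?prime_gt0 //= expr0.
  rewrite -[in RHS](expr1n _ p) (subrXX 'X) => /mulfI h.
  have {}h := congr1 (horner^~ 1) (h (negbT (polyXsubC_eq0 _))).
  move: h; rewrite horner_prod horner_sum.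
  under eq_bigr do rewrite hornerXsubC.
  move=> ->; under eq_bigr do rewrite expr1n mulr1 hornerXn expr1n.
  by rewrite sumr_const card_ord.
rewrite (@place_val_prod_const _ _ (1 - z)) // ?size_iota // => i.
rewrite mem_index_iota => /andP [i0 ip].
by rewrite (@place_val_1Bprim p) // coprime_sym prime_coprime // gtnNdvd.
Qed.

(** [1 - z ^+ p] is the product of [1 - z * y] over the [p]-th roots of unity [y]. Each [z * y] is a
    power of [z] with exponent prime to [p], so the [p] factors share one valuation. *)
Lemma place_val_1B_prime_exp p s z : prime p -> (p ^ s.+2).-primitive_root z ->
  v (1 - z ^+ p) = (w (1 - z) *+ p)%:E.
Proof.
move=> pp zN; have p1 := prime_gt1 pp; have p0 := prime_gt0 pp.
have z1 : 1 - z != 0.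
  by apply: prim_root_1B_neq0 zN; rewrite -(exp1n s.+2) ltn_exp2r.
have vz : v z = 0%E.
  by apply: place_val_unity (prim_expr_order zN); rewrite expn_gt0 p0.
have nz : z != 0 by apply: place_val_neq0 vz.
have yp : p.-primitive_root (z ^+ (p ^ s.+1)).
  have := dvdn_prim_root zN (_ : p %| p ^ s.+2)%N.
  by rewrite expnS mulKn // dvdn_mulr // => ->.
have -> : 1 - z ^+ p = \prod_(0 <= i < p) (1 - z ^+ (1 + p ^ s.+1 * i)).
  have := congr1 (horner^~ z^-1) (factor_Xn_sub_1 yp).
  rewrite horner_prod !hornerE exprVn => h.
  have -> : 1 - z ^+ p = z ^+ p * (z ^- p - 1).
    by rewrite mulrBr mulr1 divff // expf_neq0.
  rewrite -h -[in X in X * _](subn0 p) -prodr_const_nat -big_split /=.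
  apply: eq_bigr => i _; rewrite hornerXsubC mulrBr divff //.
  by rewrite exprD expr1 exprM.
rewrite (@place_val_prod_const _ _ (1 - z)) // ?size_iota ?subn0 // => i _.
rewrite (@place_val_1Bprim (p ^ s.+2)) // coprime_sym coprimeXl //.
by rewrite expnS -mulnA prime_coprime // dvdn_addl ?dvdn_mulr // dvdn1 gtn_eqF.
Qed.

(** Induction on [r] through [z ^+ p]: each level multiplies the valuation of [1 - z] by [p], down
    to primitive [p]-th roots. *)
Lemma place_val_prim_root p r z : prime p -> (p ^ r.+1).-primitive_root z ->
  v p%:R = (w (1 - z) *+ (p ^ r * (p - 1)))%:E.
Proof.
move=> pp; have p0 := prime_gt0 pp; elim: r z => [|r IH] z zN.
  by rewrite mul1n; exact: place_val_prime_root.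
have zpN : (p ^ r.+1).-primitive_root (z ^+ p).
  have := dvdn_prim_root zN (_ : p ^ r.+1 %| p ^ r.+2)%N.
  by rewrite (expnS p r.+1) mulnK ?expn_gt0 ?p0 // dvdn_mull // => ->.
by rewrite (IH _ zpN) (place_val_1B_prime_exp pp zN) /= -mulrnA mulnA -expnS.
Qed.

End Valuation.

(** * Differences of [d]-th powers for a prime power [d] *)

Lemma prime_dvd_bin_exp p e i : prime p -> (0 < i < p ^ e)%N ->
  (p %| 'C(p ^ e, i))%N.
Proof.
move=> pp; case: i => // i /andP [_ ilt]; apply: contraLR ilt => pC.
(* [p ^ e] divides [i.+1 * 'C(p ^ e, i.+1)]; were the binomial prime to [p], it would divide
   [i.+1]. *)
rewrite -leqNgt dvdn_leq // -(@Gauss_dvdl _ _ 'C(p ^ e, i.+1)).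
  by rewrite -mul_bin_diag dvdn_mulr.
by rewrite coprimeXl // prime_coprime.
Qed.

Section PrimePower.
Variables (R : archiRealDomainType) (K : fieldType) (v : finite_place R K).
Variables (p e d : nat).
Hypotheses (pp : prime p) (d_exp : d = (p ^ e)%N).
Implicit Types (x y : K).

Local Notation w x := (fine (v x)).

Lemma place_subX_prime_exp x y : (0 <= v x)%E -> (0 <= v y)%E ->
  exists2 u, (0 <= v u)%E &
    x ^+ d - y ^+ d = (x - y) ^+ d + p%:R * (x - y) * u.
Proof.
move=> x0 y0; set z := x - y; have -> : x = y + z by rewrite /z addrC subrK.
have z0 : (0 <= v z)%E by rewrite place_valD_ge ?place_valN.
have [k dE] : exists k, d = k.+1.
  by exists d.-1; rewrite prednK // d_exp expn_gt0 prime_gt0.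
(* The inner terms of the expansion of [(y + z) ^+ d], divided by [p * z]. *)
exists (\sum_(i < k) y ^+ (k - i) * z ^+ i * ('C(d, i.+1) %/ p)%:R).
  apply: place_val_sum_ge0 => i _.
  by rewrite !place_valM_ge0 ?place_valX_ge0 ?place_val_nat_ge0.
rewrite exprDn dE big_ord_recl big_ord_recr /= /bump /=.
rewrite subn0 expr0 bin0 mulr1 mulr1n !add1n subnn expr0 mul1r binn mulr1n.
rewrite addrAC subrr add0r addrC; congr (_ + _).
rewrite mulr_sumr; apply: eq_bigr => i _; rewrite add1n subSS -dE.
have /divnK {1}<- : (p %| 'C(d, i.+1))%N.
  by rewrite d_exp prime_dvd_bin_exp //= -d_exp dE ltnS.
by rewrite -mulr_natr natrM exprS; ring.
Qed.

Hypothesis p_gt0 : (0 < v p%:R%R)%E.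

(** Modulo [v], the difference of [d]-th powers is [(x - y) ^+ d]: an iterate of Frobenius, hence
    injective. *)
Lemma place_subX_prime_exp_gt0 x y : (0 <= v x)%E -> (0 <= v y)%E ->
  (0 < v (x ^+ d - y ^+ d)%R)%E -> (0 < v (x - y)%R)%E.
Proof.
move=> x0 y0; have [u u0 ->] := place_subX_prime_exp x0 y0 => vxy.
have d0 : (0 < d)%N by rewrite d_exp expn_gt0 prime_gt0.
rewrite -(place_valX_gt0 _ _ d0) -[X in v X](addrK (p%:R * (x - y) * u)).
apply: place_valB_gt => //; apply: lt_le_trans p_gt0 _; rewrite -mulrA.
by rewrite place_valM_ge // place_valM_ge0 // place_valD_ge ?place_valN.
Qed.

Lemma place_subX_prime_exp_lt x y : (0 <= v x)%E -> (0 <= v y)%E ->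
  (1 < d)%N -> x - y != 0 -> (0 < v (x - y)%R)%E ->
  (v (x - y)%R < v (x ^+ d - y ^+ d)%R)%E.
Proof.
move=> x0 y0 d1 xy; have [u u0 ->] := place_subX_prime_exp x0 y0 => vxy.
apply: place_valD_gt.
  rewrite place_valX // -(place_fineK v xy) lte_fin.
  rewrite -{1}[w _]mulr1n ltr_pMn2l //.
  by move: vxy; rewrite -(place_fineK v xy) lte_fin.
have lt_p : (v (x - y)%R < v (x - y)%R + v p%:R%R)%E.
  by rewrite lteDl // place_val_fin.
apply: lt_le_trans lt_p _.
by rewrite -place_valM [(x - y) * _]mulrC place_valM_ge.
Qed.

Lemma place_subX_prime_exp_small x y : (0 <= v x)%E -> (0 <= v y)%E ->
  x - y != 0 -> ((w (x - y)%R *+ d.-1)%:E < v p%:R%R)%E ->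
  v (x ^+ d - y ^+ d) = (w (x - y) *+ d)%:E.
Proof.
move=> x0 y0 xy; have [u u0 ->] := place_subX_prime_exp x0 y0 => vxy.
have d0 : (0 < d)%N by rewrite d_exp expn_gt0 prime_gt0.
rewrite [LHS]place_valD_lt place_valX //.
apply: lt_le_trans (place_valM_ge _ u0); rewrite place_valM.
rewrite -(prednK d0) mulrSr EFinD -(place_fineK v xy) lteD2rE //.
Qed.

Lemma place_subX_prime_exp_large x y : (0 <= v x)%E -> (0 <= v y)%E ->
  x - y != 0 -> (v p%:R%R <= (w (x - y)%R *+ d.-1)%:E)%E ->
  (v p%:R%R + v (x - y)%R <= v (x ^+ d - y ^+ d)%R)%E.
Proof.
move=> x0 y0 xy; have [u u0 ->] := place_subX_prime_exp x0 y0 => vxy.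
have d0 : (0 < d)%N by rewrite d_exp expn_gt0 prime_gt0.
apply: place_valD_ge; last by rewrite -place_valM place_valM_ge.
by rewrite place_valX // -(prednK d0) mulrSr EFinD -(place_fineK v xy) leeD2r.
Qed.

End PrimePower.

(** * The critical orbit, and the tame case *)

Section Orbit.
Variables (K : fieldType) (d m n : nat) (c : K).
Hypotheses (d_gt1 : (1 < d)%N) (m_gt0 : (0 < m)%N).
(* The preperiod is [m.+1], so that [m] is the [m - 1] of the theorem. *)
Hypothesis (type_c : exact_type d c m.+1 n).

Local Notation a i := (iter i (unicrit d c) 0).

Lemma orbitB i j : a i.+1 - a j.+1 = a i ^+ d - a j ^+ d.
Proof. by rewrite !iterS /unicrit opprD addrACA subrr addr0. Qed.

Lemma orbit_shift i j k : a i = a j -> a (k + i) = a (k + j).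
Proof. by rewrite !iterD => ->. Qed.

Lemma orbit_period_gt0 : (0 < n)%N.
Proof. by have [] := type_c. Qed.

Lemma orbit_periodic q j : (m < j)%N -> a (j + q * n) = a j.
Proof.
move=> mj; have [_ per _] := type_c.
elim: q => [|q IH]; first by rewrite addn0.
rewrite mulSn addnCA -[RHS]IH.
have -> : (n + (j + q * n) = (j + q * n - m.+1) + (m.+1 + n))%N.
  by rewrite [RHS]addnA subnK ?(leq_trans mj (leq_addr _ _)) // addnC.
by rewrite (orbit_shift _ per) subnK // (leq_trans mj (leq_addr _ _)).
Qed.

Lemma orbit_eq_dvd i : a (m.+1 + i) = a m.+1 -> (n %| i)%N.
Proof.
have [n0 _ mini] := type_c => per; rewrite /dvdn -leqn0 leqNgt.
(* A nonzero remainder [i %% n] would be a period smaller than [n]. *)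
apply/negP => /(mini m.+1) [|_]; last by rewrite leqNgt ltn_mod n0.
rewrite -(orbit_periodic (i %/ n)) ?leq_addr //.
by rewrite -addnA [(_ %% _ + _)%N]addnC -divn_eq.
Qed.

Lemma orbit_neq0 i : (0 < i)%N -> a i != 0.
Proof.
have [_ _ mini] := type_c.
by move=> i0; apply/eqP => ai0; case: (mini 0%N i i0 ai0).
Qed.

Lemma orbitB_neq0 j : (j <= m)%N -> a (j + n) - a j != 0.
Proof.
have [n0 _ mini] := type_c.
by move=> jm; apply/eqP => /subr0_eq /(mini j n n0) []; rewrite ltnNge jm.
Qed.

Lemma orbit_zeta_exp : (a (m + n) / a m) ^+ d = 1.
Proof.
have [_ per _] := type_c.
have : a (m + n) ^+ d - a m ^+ d = 0 by rewrite -orbitB -addSn per subrr.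
by move=> /subr0_eq h; rewrite exprMn h exprVn divff // expf_neq0 // orbit_neq0.
Qed.

Lemma orbit_zeta_neq1 : 1 - a (m + n) / a m != 0.
Proof.
have a0 := orbit_neq0 m_gt0.
have := orbitB_neq0 (leqnn m); apply: contraNneq => /subr0_eq h.
by rewrite -(divfK a0 (a (m + n))) -h mul1r subrr.
Qed.

Variables (R : archiRealDomainType) (v : finite_place R K).
Local Notation w x := (fine (v x)).

Lemma orbit_zetaB :
  v (a (m + n) - a m) = (v (1 - a (m + n) / a m)%R + v (a m))%E.
Proof.
by rewrite -place_valM mulrBl mul1r divfK ?orbit_neq0 // place_valBC.
Qed.

(** If [v c < 0], then [a i ^+ d] dominates [c] at every step after the first, so the valuations
    decrease strictly along the orbit and it cannot be preperiodic. *)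
Lemma place_val_param_ge0 : (0 <= v c)%E.
Proof.
rewrite leNgt; apply/negP => vc.
have c0 : c != 0 by apply/eqP => c0; move: vc; rewrite c0 place_val0.
have lt_of i : (v (a i.+1) <= v c)%E -> (v (a i.+2) < v (a i.+1))%E.
  move=> le_c; have ai0 := orbit_neq0 (ltn0Sn i).
  have lt_a : (v (a i.+1 ^+ d)%R < v (a i.+1))%E.
    rewrite place_valX // -(place_fineK v ai0) lte_fin -[ltRHS]mulr1n.
    rewrite ltr_nMn2l //; move: (le_lt_trans le_c vc).
    by rewrite -(place_fineK v ai0) lte_fin.
  rewrite [a i.+2]iterS {1}/unicrit place_valD_lt //.
  exact: lt_le_trans lt_a le_c.
have le_c i : (v (a i.+1) <= v c)%E.
  elim: i => [|i IH]; last exact/ltW/(lt_le_trans (lt_of _ IH)).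
  by rewrite /= /unicrit expr0n gtn_eqF ?add0r // ltnW.
have decr k : (v (a (m.+1 + k.+1)) < v (a m.+1))%E.
  elim: k => [|k IH]; first by rewrite addn1 lt_of.
  by apply: lt_trans IH; rewrite !addnS lt_of.
have [n0 per _] := type_c.
by have := decr n.-1; rewrite prednK // per ltxx.
Qed.

Lemma place_val_orbit_ge0 i : (0 <= v (a i))%E.
Proof.
elim: i => [|i IH]; first by rewrite place_val0 leey.
by rewrite iterS place_valD_ge ?place_valX_ge0 ?place_val_param_ge0.
Qed.

Lemma place_val_orbitB_le i j k :
  (v (a i - a j)%R <= v (a (k + i) - a (k + j))%R)%E.
Proof.
elim: k => [//|k IH]; apply: le_trans IH _; rewrite !addSn orbitB.
by rewrite place_val_subX ?place_val_orbit_ge0.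
Qed.

Lemma place_val_orbitB_gt0 i j k :
  (0 < v (a i - a j)%R)%E -> (0 < v (a (k + i) - a (k + j))%R)%E.
Proof. by move=> h; apply: lt_le_trans (place_val_orbitB_le _ _ _). Qed.

(* [f^j(z) - f^j(0)] is divisible by [z^d], the critical point being [0]. *)
Lemma place_val_orbitB_ge i j : (0 < i)%N -> (0 < j)%N ->
  ((w (a i) *+ d)%:E <= v (a (j + i) - a j)%R)%E.
Proof.
move=> i0; case: j => // j _; rewrite -place_valX ?orbit_neq0 //.
have := place_val_orbitB_le i.+1 1 j; rewrite orbitB /= expr0n.
by rewrite gtn_eqF ?subr0 ?addn1 ?addnS // ltnW.
Qed.

(** Advancing [q.+1 * i] by [i] alters [a i] by a term of valuation at least [d] times that of
    [a (q.+1 * i)], which is strictly larger than [v (a i)]. *)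
Lemma place_val_orbit_mul i q : (0 < i)%N -> (0 < v (a i))%E ->
  v (a (q.+1 * i)) = v (a i).
Proof.
move=> i0 ai; elim: q => [|q IH]; first by rewrite mul1n.
have qi0 : (0 < q.+1 * i)%N by rewrite muln_gt0.
rewrite mulSn -[in LHS](subrK (a i) (a _)) addrC place_valD_lt //.
apply: lt_le_trans (place_val_orbitB_ge qi0 i0); rewrite IH.
move: ai; rewrite -(place_fineK v (orbit_neq0 i0)) !lte_fin => wi.
by rewrite -[ltLHS]mulr1n /= ltr_pMn2l.
Qed.

Lemma place_val_orbit_tame : v d%:R = 0%E ->
  forall i, (0 < i)%N -> v (a i) = 0%E.
Proof.
move=> vd i i0; apply/eqP; rewrite eq_sym; apply: contraTT isT => nz.
have {nz}ai : (0 < v (a i))%E by rewrite lt_neqAle nz place_val_orbit_ge0.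
have n0 := orbit_period_gt0.
(* [a (m.+1 * i)] lies in the cycle, hence is unchanged by [n] more steps; being congruent to 0, it
   is then congruent to [a n]. *)
have an : (0 < v (a n))%E.
  have /(place_val_orbitB_gt0 n) h : (0 < v (a (m.+1 * i) - a 0)%R)%E.
    by rewrite subr0 place_val_orbit_mul.
  rewrite -[a n](subKr (a (m.+1 * i))); apply: place_valB_gt.
    by rewrite place_val_orbit_mul.
  rewrite -(orbit_periodic 1 (_ : m < m.+1 * i)%N) ?leq_pmulr // mul1n addnC.
  by move: h; rewrite addn0.
set z := a (m + n) / a m.
have vz : v z = 0%E by apply: place_val_unity orbit_zeta_exp; exact: ltnW.
have z1 : v (1 - z) = 0%E.
  apply/eqP; rewrite eq_sym; apply: contraTT isT => nz.
  have {nz}z1 : (0 < v (1 - z)%R)%E.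
    by rewrite lt_neqAle nz place_valD_ge ?place_valN ?vz ?place_val1.
  (* The powers of [z] sum to 0, so [d] is the sum of the [1 - z ^+ i], each divisible by [1 - z];
     this would force [v d] to be positive. *)
  have sum0 : \sum_(i < d) z ^+ i = 0.
    apply: (mulfI orbit_zeta_neq1); rewrite mulr0 -[LHS]opprK -mulNr opprB.
    by rewrite -subrX1 orbit_zeta_exp subrr oppr0.
  suff : (v (1 - z)%R <= v d%:R%R)%E by rewrite vd leNgt z1.
  have -> : d%:R = \sum_(i < d) (1 - z ^+ i).
    by rewrite sumrB sum0 subr0 sumr_const card_ord.
  elim/big_ind: _ => [|x y|k _]; first by rewrite place_val0 leey.
    exact: place_valD_ge.
  by rewrite -[X in (X - z ^+ k)%R](expr1n _ k) place_val_subX ?place_val1 ?vz.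
have am : (0 < v (a m))%E.
  have := place_val_orbitB_gt0 m (_ : 0 < v (a n - a 0)%R)%E.
  by rewrite addn0 orbit_zetaB z1 add0e subr0; apply.
have := place_val_orbitB_ge n0 m_gt0; rewrite orbit_zetaB z1 add0e.
(* [a m] and [a n] both have the valuation of [a (m * n)], so the bound reads
   [d * v (a n) <= v (a n)]. *)
rewrite -(place_val_orbit_mul n.-1 m_gt0 am) prednK // mulnC.
rewrite -[in (_ * n)%N](prednK m_gt0) place_val_orbit_mul //.
move: an; rewrite -(place_fineK v (orbit_neq0 n0)) lte_fin lee_fin => wn.
by rewrite leNgt -[ltLHS]mulr1n ltr_pMn2l ?d_gt1.
Qed.

(** * The wild case: [d] a power of [p] and [v p > 0] *)

Section Wild.
Variables (p e : nat).
Hypotheses (pp : prime p) (d_exp : d = (p ^ e)%N) (p_gt0 : (0 < v p%:R%R)%E).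

(** The difference [a (j + n) - a j] vanishes at [j = m.+1]; injectivity modulo [v] carries its
    positive valuation down to [j = 0], where it is [a n]. *)
Lemma place_val_orbit_period_gt0 : (0 < v (a n))%E.
Proof.
suff down k j : (0 < v (a (j + k + n) - a (j + k))%R)%E ->
    (0 < v (a (j + n) - a j)%R)%E.
  have [_ per _] := type_c.
  have := down m.+1 0%N; rewrite add0n per subrr subr0; apply.
  by rewrite place_val0 ltry.
elim: k => [|k IH]; first by rewrite addn0.
rewrite addnS addSn orbitB => h; apply: IH.
by apply: (place_subX_prime_exp_gt0 pp d_exp p_gt0 _ _ h);
  apply: place_val_orbit_ge0.
Qed.

(* [f] strictly contracts residue discs, so two points of the cycle that are
   congruent are equal. *)
Lemma place_val_orbit_gt0_dvd i : (0 < v (a i))%E -> (n %| i)%N.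
Proof.
move=> ai; apply: orbit_eq_dvd; apply/subr0_eq/eqP; apply: contraTT isT => nz.
have pos k : (0 < v (a (k + i) - a k)%R)%E.
  have := place_val_orbitB_gt0 (i := i) (j := 0) k.
  by rewrite addn0 subr0; apply.
have n0 := orbit_period_gt0.
have back k : a (m.+1 + k * n + i) - a (m.+1 + k * n) = a (m.+1 + i) - a m.+1.
  by rewrite addnAC !orbit_periodic // leq_addr.
have mono j k : a (j + i) - a j != 0 -> (v (a (j + i) - a j)%R <
    v (a (k.+1 + (j + i)) - a (k.+1 + j))%R)%E.
  move=> nzj; elim: k => [|k IH]; rewrite !addSn orbitB.
    by apply: (place_subX_prime_exp_lt pp d_exp) => //;
      exact: place_val_orbit_ge0.
  apply: lt_le_trans IH _; rewrite !addSn.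
  by apply: place_val_subX; exact: place_val_orbit_ge0.
(* After [n] further steps the same difference recurs, so its valuation would exceed itself. *)
have := mono m.+1 n.-1 nz.
rewrite prednK // addnA (addnC n) -{1 2}(mul1n n) back.
by rewrite ltxx.
Qed.

Lemma place_val_orbit_wild i : (0 < i)%N ->
  v (a i) = if (n %| i)%N then v (a n) else 0%E.
Proof.
move=> i0; case: ifPn => [/dvdnP [q iE]|ndiv].
  move: i0; rewrite iE; case: q {iE} => // q _.
  by rewrite place_val_orbit_mul ?orbit_period_gt0 ?place_val_orbit_period_gt0.
apply/eqP; rewrite eq_le place_val_orbit_ge0 andbT leNgt.
by apply: contra ndiv; exact: place_val_orbit_gt0_dvd.
Qed.

Variable r : nat.
Hypothesis zeta_prim : (p ^ r.+1).-primitive_root (a (m + n) / a m).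

Local Notation D j := (a (j + n) - a j).
Local Notation wz := (w (1 - a (m + n) / a m)).

Let n_gt0 : (0 < n)%N := orbit_period_gt0.

Let wp_zeta : v p%:R = (wz *+ (p ^ r * (p - 1)))%:E.
Proof. exact: place_val_prim_root. Qed.

Let pNneq0 : p%:R != 0 :> K := place_val_neq0 wp_zeta.

Let wpE : (w p%:R)%:E = v p%:R := place_fineK v pNneq0.

Let wn_gt0 : 0 < w (a n).
Proof.
rewrite -lte_fin place_fineK ?orbit_neq0 //.
exact: place_val_orbit_period_gt0.
Qed.

Let wz_le : wz <= w p%:R.
Proof.
move: p_gt0; rewrite wp_zeta /= lte_fin; set N := (_ * _)%N => wzN.
have N0 : (0 < N)%N by case: N wzN => //; rewrite mulr0n ltxx.
rewrite -[leLHS]mulr1n ler_wpMn2l //.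
by rewrite ltW // -(pmulrn_lgt0 _ N0).
Qed.

Let wDm : w (D m) = wz + w (a m).
Proof.
apply: EFin_inj; rewrite EFinD !place_fineK ?orbitB_neq0 ?orbit_neq0 //.
  exact: orbit_zetaB.
exact: orbit_zeta_neq1.
Qed.

Let wam_le : w (a m) <= w (a n).
Proof. by rewrite place_val_orbit_wild //; case: ifP => // _; rewrite ltW. Qed.

Let wD_small j : (0 < j < m)%N -> w (D j) *+ d.-1 < w p%:R.
Proof.
move=> /andP [j0 jm]; rewrite ltNge; apply/negP => large.
have Dj0 := orbitB_neq0 (ltnW jm); have Dj1 := orbitB_neq0 jm.
have {}large : w p%:R + w (D j) <= w (D j.+1).
  rewrite -lee_fin EFinD !place_fineK // addSn orbitB.
  apply: (place_subX_prime_exp_large pp d_exp) => //;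
    try exact: place_val_orbit_ge0.
  by rewrite -wpE lee_fin.
(* Since [j > 0], [D j] already has valuation strictly above [w (a n)], hence above [w (a m)];
   together with [wz <= w p] this pushes [D m] beyond [wz + w (a m)]. *)
have Dj_ge : w (a n) *+ d <= w (D j).
  by rewrite -lee_fin place_fineK // place_val_orbitB_ge.
have le_m : w (D j.+1) <= w (D m).
  rewrite -lee_fin !place_fineK ?orbitB_neq0 //.
  have := place_val_orbitB_le (j.+1 + n) j.+1 (m - j.+1).
  by rewrite addnA subnK.
have : w (a n) *+ 1 < w (a n) *+ d by rewrite ltr_pMn2l.
rewrite mulr1n; move: wDm wam_le wz_le; lra.
Qed.

Let wDE j : (j <= m)%N -> w (D j) = w (a n) *+ d ^ j.
Proof.
elim: j => [_|j IH jm]; first by rewrite add0n subr0 mulr1n.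
rewrite expnSr mulrnA -IH ?(ltnW jm) //.
have Dj0 := orbitB_neq0 (ltnW jm).
apply: EFin_inj; rewrite place_fineK ?orbitB_neq0 // addSn orbitB.
(* At [j = 0] the subtracted power is 0, so the value is exact and needs no smallness bound;
   [wD_small] starts at 1. *)
case: j {IH} jm Dj0 => [|j] jm Dj0.
  by rewrite add0n expr0n gtn_eqF ?subr0 ?place_valX ?orbit_neq0 // ltnW.
rewrite (place_subX_prime_exp_small pp d_exp) ?place_val_orbit_ge0 //.
by rewrite -wpE lte_fin wD_small.
Qed.

(** Compares the two values of [w (D m)], namely [w (a n) *+ d ^ m] and [wz + w (a m)]. The boolean
    [n %| m], read as 0 or 1, treats (a) and (b) together, since [w (a m)] is [w (a n)] or 0. *)
Lemma place_val_orbit_period :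
  ((p ^ r * (p - 1) * (d ^ m - (n %| m)))%N%:R%:E * v (a n) = v p%:R%R)%E.
Proof.
have wn := place_fineK v (orbit_neq0 n_gt0).
have am : w (a m) = w (a n) *+ (n %| m).
  by rewrite place_val_orbit_wild //; case: ifP.
have dm : ((n %| m) <= d ^ m)%N.
  by rewrite (leq_trans (leq_b1 _)) // expn_gt0 ltnW.
rewrite wp_zeta -wn -EFinM mulr_natl mulnC mulrnA; congr (_ *+ _)%:E.
by have := wDm; rewrite wDE // am mulrnBr // => ->; rewrite addrK.
Qed.

Lemma place_val_orbit_wild_formula i : (0 < i)%N ->
  ((p ^ r * (p - 1) * (d ^ m - (n %| m)))%N%:R%:E * v (a i)
     = if (n %| i)%N then v p%:R%R else 0)%E.
Proof.
move=> i0; rewrite place_val_orbit_wild //.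
by case: ifP => _; [exact: place_val_orbit_period | rewrite mule0].
Qed.

End Wild.
End Orbit.

(** * Passage to [Qadj c0] and conclusion *)

Lemma crit_atE (A : comNzRingType) d i (c : A) :
  crit_at d i c = iter i (unicrit d c) 0.
Proof.
rewrite /crit_at /crit_poly; elim: i => [|i IH].
  by rewrite rmorph0 horner0.
rewrite !iterS {1}/unicrit rmorphD rmorphXn /= map_polyX.
by rewrite hornerD horner_exp hornerX IH.
Qed.

(** Brings the hypothesis on [c0] in [algC] back to the generator of [Qadj c0]; field morphisms are
    injective, so they reflect coincidences in the orbit. *)
Lemma exact_type_rmorph (K L : fieldType) (f : {rmorphism K -> L}) d c m n :
  exact_type d (f c) m n -> exact_type d c m n.
Proof.
have orbE i : iter i (unicrit d (f c)) 0 = f (iter i (unicrit d c) 0).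
  elim: i => [|i IH]; first by rewrite rmorph0.
  by rewrite !iterS IH /unicrit rmorphD rmorphXn.
case=> n0; rewrite !orbE => /fmorph_inj per mini; split=> // m' n' n'0 per'.
by apply: mini => //; rewrite !orbE per'.
Qed.

(** The order of [z] is a power of [p], not 1 as [z != 1], and minimality of [r] fixes the
    exponent. *)
Lemma prim_root_prime_exp_min (K : fieldType) p r (z : K) : prime p -> z != 1 ->
  z ^+ (p ^ r.+1) = 1 -> (forall s, z ^+ (p ^ s.+1) = 1 -> (r <= s)%N) ->
  (p ^ r.+1).-primitive_root z.
Proof.
move=> pp z1 zr min_r.
have [|k zk] := prim_order_exists _ zr; first by rewrite expn_gt0 prime_gt0.
case/(dvdn_pfactor _ _ pp) => -[|s] sr kE; move: zk; rewrite {k}kE => zk.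
  by case/eqP: z1; rewrite -[z]expr1 (prim_expr_order zk).
suff <- : s = r by [].
by apply/eqP; rewrite eqn_leq -ltnS sr min_r ?(prim_expr_order zk).
Qed.

Theorem theorem3p3 (d m n : nat) (hd : (2 <= d)%N) (hm : (2 <= m)%N)
    (hn : (1 <= n)%N) (c0 : algC)
    (R : archiRealDomainType) (v : finite_place R (Qadj c0))
    (hpcf : exact_type d c0 m n) (hm0 : (0 < m)%N) :
  let a (i : nat) : Qadj c0 := crit_at d i (Qadj_gen c0) in
  (v d%:R = 0%E -> forall i : nat, (1 <= i)%N -> v (a i) = 0%E)
  /\
  (forall p e : nat, prime p -> d = (p ^ e)%N ->
   let zeta := a (m + n - 1)%N / a (m - 1)%N in
   forall r : nat, (r <= e - 1)%N ->
     zeta ^+ (p ^ r.+1) = 1 ->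
     (forall s : nat, zeta ^+ (p ^ s.+1) = 1 -> (r <= s)%N) ->
   forall i : nat, (1 <= i)%N ->
     (~~ (n %| m - 1)%N ->
        ((p ^ r * (p - 1) * d ^ (m - 1))%N%:R%:E * v (a i)
           = if (n %| i)%N then v p%:R else 0)%E)
     /\
     ((n %| m - 1)%N ->
        ((p ^ r * (p - 1) * (d ^ (m - 1) - 1))%N%:R%:E * v (a i)
           = if (n %| i)%N then v p%:R else 0)%E)).
Proof.
case: m hm hm0 hpcf => // k k0 _ typ a.
have {}typ : exact_type d (Qadj_gen c0) k.+1 n.
  by move: typ; rewrite -{1}(Qadj_inj_gen c0); exact: exact_type_rmorph.
have aE i : a i = iter i (unicrit d (Qadj_gen c0)) 0 := crit_atE _ _ _.
have tame : v d%:R = 0%E -> forall i, (1 <= i)%N -> v (a i) = 0%E.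
  by move=> vd i i0; rewrite aE (place_val_orbit_tame hd k0 typ).
split=> // p e pp dE zeta r _ zr min_r i i0.
have zetaE : zeta = iter (k + n) (unicrit d (Qadj_gen c0)) 0
                      / iter k (unicrit d (Qadj_gen c0)) 0.
  by rewrite /zeta !aE addSn !subSS !subn0.
suff main : ((p ^ r * (p - 1) * (d ^ k - (n %| k)))%N%:R%:E * v (a i)
               = if (n %| i)%N then v p%:R%R else 0)%E.
  rewrite !subSS !subn0; split=> [/negbTE nk|nk]; move: main; rewrite nk //.
  by rewrite subn0.
have [p_gt0|] := boolP (0 < v p%:R%R)%E.
  rewrite aE; apply: (place_val_orbit_wild_formula hd k0 typ pp dE) => //.
  rewrite -zetaE; apply: prim_root_prime_exp_min => //.
  by rewrite eq_sym -subr_eq0 zetaE; exact: (orbit_zeta_neq1 k0 typ).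
(* Otherwise [v p = 0], hence [v d = 0]; the tame case makes both sides 0. *)
rewrite -leNgt => p_le0.
have vp : v p%:R = 0%E by apply/le_anti; rewrite p_le0 place_val_nat_ge0.
rewrite tame ?vp ?mule0 ?if_same // dE natrX place_valX ?(place_val_neq0 vp) //.
by rewrite vp mul0rn.
Qed.
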